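(* Let $c\in(0,1)$ and $a\in[0,1)$. Suppose the standing assumptions in the context hold, and run the online optimization algorithm with prediction (described in the context) for $T$ rounds with $\eta_t=\eta=1/T^{c}$ and $\gamma_t=\gamma=\frac{1}{G\sqrt{\eta}}$ for all $t$. Let $\mathcal{K}=\{x\in\mathcal{X}: g_t(x)\le 0 \text{ componentwise for all } t\}$ and $$R_T=\sum_{t=1}^T f_t(x_t)-\min_{x\in\mathcal{K}}\sum_{t=1}^T f_t(x),\qquad C_T=\sum_{t=1}^T\sum_{j=1}^m \{g_t^j(x_t)\}_+ .$$ Then, when the predictions satisfy $\|c_t-h_t\|=\mathcal{O}(T^{-a/2})$, $$R_T\le \mathcal{O}\big(T^{\max\{1-a-c,\,c\}}\big),\qquad C_T\le \mathcal{O}\big(T^{1/2-c/2}\big).$$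
   Context: Setting (online convex optimization with long term constraints and predictions). At each round $t$ the learner plays $x_t\in\mathcal{X}\subseteq\mathbb{R}^p$, incurs the cost $f_t(x_t)$, and then receives full information feedback (it observes $c_t$, defined below). An oracle supplies, before time $t$, a hint (prediction) $h_t\in\mathbb{R}^p$ of $c_t$. The constraint functions $g_t=(g_t^1,\dots,g_t^m)^\top$, $g_t^j:\mathbb{R}^p\to\mathbb{R}$, are known in advance. Standing assumptions. (i) $\mathcal{X}$ is closed and convex. (ii) $g_t$ is convex (each $g_t^j$ is convex) for all $t$. (iii) The costs are linear: $f_t(x)=\langle c_t,x\rangle$ with $c_t\in\mathbb{R}^p$. (iv) The subgradients of $f_t$ (that is, $c_t$) and of $g_t$ at every $x\in\mathcal{X}$ are bounded in norm by a constant $G$; for $g_t$ this is a bound on the operator norm of any $m\times p$ matrix whose rows are subgradients of the $g_t^j$ at $x$. (v) $|f_t(x)|\le F$ and $\|g_t(x)\|\le F$ for all $x\in\mathcal{X}$, for a constant $F$. Notation. $\|\cdot\|$ is the Euclidean norm. $\{u\}_+=\max\{u,0\}$ for a real $u$, and $[v]_+$ is the componentwise non-negative part of a vector $v$. $\mathcal{R}$ is a differentiable function that is $1$-strongly convex with respect to $\|\cdot\|_2$, and $D_{\mathcal{R}}(x,y)=\mathcal{R}(x)-\mathcal{R}(y)-\langle\nabla\mathcal{R}(y),x-y\rangle$ is its Bregman divergence. Algorithm (online optimization with prediction), with parameters $\eta_t>0$, $\gamma_t>0$. Initialize $x_1=z_1=\arg\min_{z\in\mathcal{X}}\mathcal{R}(z)$,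 $q_0=0\in\mathbb{R}^m$, and $\hat q_0=q_0+\gamma_1[g_1(z_1)]_+$. For $t=1,\dots,T$: play $x_t$, suffer cost $f_t(x_t)$ and constraint violation $[g_t(x_t)]_+$; observe $c_t$ and the hint $h_{t+1}$; then update $$q_t=q_{t-1}+\gamma_t[g_t(x_t)]_+,$$ $$z_{t+1}=\arg\min_{z\in\mathcal{X}}\ \eta_{t+1}\langle z,c_t\rangle+\eta_{t+1}\gamma_t\langle\hat q_{t-1},[g_t(z)]_+\rangle+D_{\mathcal{R}}(z,z_t),$$ $$\hat q_t=q_t+\gamma_{t+1}[g_{t+1}(z_{t+1})]_+,$$ $$x_{t+1}=\arg\min_{x\in\mathcal{X}}\ \eta_{t+1}\langle x,h_{t+1}\rangle+\eta_{t+1}\gamma_{t+1}\langle\hat q_t,[g_{t+1}(x)]_+\rangle+D_{\mathcal{R}}(x,z_{t+1}).$$ (The updates of $\hat q_T$ and $x_{T+1}$ in the last round play no role.)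
   Formalization: The constant hidden in O(.) is a nondecreasing function of D_R(x*,x_1), where x* is the minimizer over K; for unbounded X a constant independent of this divergence is impossible, so the stated rates hold when D_R(x*,x_1) stays bounded in T (for example when X is bounded). *)

(* Defs.v *)
From HB Require Import structures.
From mathcomp Require Import all_boot all_order all_algebra.
From mathcomp Require Import all_classical all_reals all_analysis.

Set Implicit Arguments.
Unset Strict Implicit.
Unset Printing Implicit Defensive.

Import Order.TTheory GRing.Theory Num.Theory.
Import numFieldNormedType.Exports.

Local Open Scope classical_set_scope.
Local Open Scope ring_scope.

Section Euclidean.
Context {R : realType}.

Definition dot n (u v : 'cV[R]_n) : R := \sum_(i < n) u i 0 * v i 0.

(* The library's norm `|u| on matrices is the max norm, not the Euclidean one;
   both induce the same topology. *)
Definition enorm n (u : 'cV[R]_n) : R := Num.sqrt (dot u u).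

Definition opnorm m n (A : 'M[R]_(m, n)) : R :=
  sup [set enorm (A *m v) | v in [set v : 'cV[R]_n | enorm v <= 1]].

Definition pospart n (v : 'cV[R]_n) : 'cV[R]_n :=
  map_mx (fun r => Num.max r 0) v.

Definition is_argmin (U : Type) (D : set U) (f : U -> R) (x : U) : Prop :=
  D x /\ forall y, D y -> f x <= f y.

Definition subgradient n (f : 'cV[R]_n -> R) (x s : 'cV[R]_n) : Prop :=
  forall y, f x + dot s (y - x) <= f y.

(* [A] is an m x n matrix whose j-th row is a subgradient of the j-th
   component of [g] at [x]. *)
Definition subgradient_mx m n (g : 'cV[R]_n -> 'cV[R]_m) (x : 'cV[R]_n)
    (A : 'M[R]_(m, n)) : Prop :=
  forall j, subgradient (fun y => g y j 0) x (row j A)^T.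

Definition strongly_convex n (D : set 'cV[R]_n) (mu : R)
    (f : 'cV[R]_n -> R) : Prop :=
  forall x y (l : R), D x -> D y -> 0 <= l <= 1 ->
    f (l *: x + (1 - l) *: y) <=
      l * f x + (1 - l) * f y - mu / 2 * l * (1 - l) * enorm (x - y) ^+ 2.

(* 'd f y is the differential of f at y, so 'd f y (x - y) is the inner
   product of the gradient of f at y with x - y. *)
Definition bregman n (f : 'cV[R]_n -> R) (x y : 'cV[R]_n) : R :=
  f x - f y - 'd f y (x - y).

End Euclidean.

(* All sequences are indexed from 1, except q and qh (the auxiliary sequence
   written with a hat) which are indexed from 0; the other values are junk. *)
Section OnlineProblem.
Context {R : realType} {p m : nat}.
Implicit Types (X : set 'cV[R]_p) (g : nat -> 'cV[R]_p -> 'cV[R]_m).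
Implicit Types (cost hint x z : nat -> 'cV[R]_p) (q qh : nat -> 'cV[R]_m).

(* The cost functions are f_t(y) = dot (cost t) y. *)
Record standing_assumptions (T : nat) X cost g (G F : R) : Prop := {
  sa_closed : closed X;
  sa_convex : convex_set X;
  sa_constraint_convex : forall t j, (1 <= t <= T)%N ->
    convex_function setT (fun y => g t y j 0);
  sa_cost_subgradient : forall t, (1 <= t <= T)%N -> enorm (cost t) <= G;
  sa_constraint_subgradient : forall t y A, (1 <= t <= T)%N -> X y ->
    subgradient_mx (g t) y A -> opnorm A <= G;
  sa_cost_bound : forall t y, (1 <= t <= T)%N -> X y ->
    `|dot (cost t) y| <= F;
  sa_constraint_bound : forall t y, (1 <= t <= T)%N -> X y ->
    enorm (g t y) <= F
}.

(* A run of T rounds. The updates of qh T and x T.+1, which would need round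
   T.+1 data and are never used, are left out. *)
Record algorithm_run (T : nat) X (Reg : 'cV[R]_p -> R) (eta gamma : nat -> R)
    cost hint g x z q qh : Prop := {
  run_z1 : is_argmin X Reg (z 1%N);
  run_x1 : x 1%N = z 1%N;
  run_q0 : q 0%N = 0;
  run_qh0 : qh 0%N = q 0%N + gamma 1%N *: pospart (g 1%N (z 1%N));
  run_q : forall t, (1 <= t <= T)%N ->
    q t = q t.-1 + gamma t *: pospart (g t (x t));
  run_z : forall t, (1 <= t <= T)%N ->
    is_argmin X (fun y => eta t.+1 * dot y (cost t)
                 + eta t.+1 * gamma t * dot (qh t.-1) (pospart (g t y))
                 + bregman Reg y (z t)) (z t.+1);
  run_qh : forall t, (1 <= t < T)%N ->
    qh t = q t + gamma t.+1 *: pospart (g t.+1 (z t.+1));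
  run_x : forall t, (1 <= t < T)%N ->
    is_argmin X (fun y => eta t.+1 * dot y (hint t.+1)
                 + eta t.+1 * gamma t.+1 * dot (qh t) (pospart (g t.+1 y))
                 + bregman Reg y (z t.+1)) (x t.+1)
}.

Definition feasible (T : nat) X g : set 'cV[R]_p :=
  [set y | X y /\ forall t j, (1 <= t <= T)%N -> g t y j 0 <= 0].

Definition total_cost (T : nat) cost (y : nat -> 'cV[R]_p) : R :=
  \sum_(1 <= t < T.+1) dot (cost t) (y t).

Definition is_best_feasible (T : nat) X cost g (u : 'cV[R]_p) : Prop :=
  is_argmin (feasible T X g) (fun y => total_cost T cost (fun=> y)) u.

(* The regret R_T when [u] is a best feasible point. *)
Definition regret (T : nat) cost x (u : 'cV[R]_p) : R :=
  total_cost T cost x - total_cost T cost (fun=> u).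

Definition violation (T : nat) g x : R :=
  \sum_(1 <= t < T.+1) \sum_(j < m) Num.max (g t (x t) j 0) 0.

End OnlineProblem.

(* Main.v *)
Require Import Defs.
From HB Require Import structures.
From mathcomp Require Import all_boot all_order all_algebra.
From mathcomp Require Import all_classical all_reals all_analysis.
From mathcomp Require Import ring lra.

Set Implicit Arguments.
Unset Strict Implicit.
Unset Printing Implicit Defensive.

Import Order.TTheory GRing.Theory Num.Theory.
Import numFieldNormedType.Exports.

Local Open Scope classical_set_scope.
Local Open Scope ring_scope.

(* Adding the three-point inequalities of the two proximal steps of a round
   bounds [eta * (f_t(x_t) - f_t(u)) + eta * gamma * <qh_(t-1), [g_t(x_t)]_+>]
   by a telescoping difference of divergences, plus
   [eta^2 / 2 * |c_t - h_t|^2], minus [|x_t - z_t|^2 / 2]. The last term absorbs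
   the error made in replacing the queue term by the increment of
   [eta / 2 * |q_t|^2], because [eta * gamma^2 * G^2 = 1]. The first round, where
   [x_1 = z_1] is not a proximal step, costs [2 F eta + F^2 / (2 G^2)]. Summing
   bounds [R_T + |q_T|^2 / 2]; the violation is the sum of the entries of
   [q_T / gamma], and is bounded using [- R_T <= 2 F T]. *)

(** * Euclidean inner product and norm *)

Section DotProduct.
Context {R : realType} {n : nat}.
Implicit Types u v w : 'cV[R]_n.

Lemma dotC u v : dot u v = dot v u.
Proof. by apply: eq_bigr => i _; rewrite mulrC. Qed.

Lemma dotDr u v w : dot u (v + w) = dot u v + dot u w.
Proof. by rewrite -big_split; apply: eq_bigr => i _; rewrite mxE mulrDr. Qed.

Lemma dotZr k u v : dot u (k *: v) = k * dot u v.
Proof. by rewrite mulr_sumr; apply: eq_bigr => i _; rewrite mxE mulrCA. Qed.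

Lemma dotBr u v w : dot u (v - w) = dot u v - dot u w.
Proof. by rewrite -scaleN1r dotDr dotZr mulN1r. Qed.

Lemma dotDl u v w : dot (u + v) w = dot u w + dot v w.
Proof. by rewrite !(dotC _ w) dotDr. Qed.

Lemma dotZl k u v : dot (k *: u) v = k * dot u v.
Proof. by rewrite !(dotC _ v) dotZr. Qed.

Lemma dotBl u v w : dot (u - v) w = dot u w - dot v w.
Proof. by rewrite !(dotC _ w) dotBr. Qed.

Lemma dot0r u : dot u 0 = 0.
Proof. by rewrite -(scale0r 0) dotZr mul0r. Qed.

Lemma dot_ge0 u v :
  (forall i, 0 <= u i 0) -> (forall i, 0 <= v i 0) -> 0 <= dot u v.
Proof. by move=> u0 v0; apply: sumr_ge0 => i _; rewrite mulr_ge0. Qed.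

Lemma dotvv_ge0 u : 0 <= dot u u.
Proof. by apply: sumr_ge0 => i _; rewrite -expr2 sqr_ge0. Qed.

Lemma enorm_ge0 u : 0 <= enorm u.
Proof. exact: sqrtr_ge0. Qed.

Lemma sqr_enorm u : enorm u ^+ 2 = dot u u.
Proof. by rewrite sqr_sqrtr// dotvv_ge0. Qed.

Lemma enorm_le u r : enorm u <= r -> dot u u <= r ^+ 2.
Proof.
move=> ur; rewrite -sqr_enorm ler_sqr// nnegrE; first exact: enorm_ge0.
exact: le_trans (enorm_ge0 _) ur.
Qed.

(** Expand |u - v|^2 >= 0. This form of Young's inequality does the work of Cauchy-Schwarz
    throughout. *)
Lemma le2_dot u v : 2 * dot u v <= dot u u + dot v v.
Proof.
have := dotvv_ge0 (u - v); rewrite dotBl !dotBr (dotC v u) => h; lra.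
Qed.

Lemma dotvv0_eq0 u : dot u u = 0 -> u = 0.
Proof.
move=> /eqP; rewrite psumr_eq0; last by move=> i _; rewrite -expr2 sqr_ge0.
move=> /allP u0; apply/colP => i; rewrite mxE.
by have := u0 i (mem_index_enum _); rewrite /= mulf_eq0 orbb => /eqP.
Qed.

End DotProduct.

(** * Convexity along segments *)

Section ConvexOn.
Context {R : realType} {n : nat}.
Implicit Types (D : set 'cV[R]_n) (f : 'cV[R]_n -> R).

(** The coefficient is a plain real, so that [lra] can combine instances; [convex_set_segment] and
    [convex_function_on] translate from bundled coefficients. *)
Definition convex_on D f := forall x y (l : R), D x -> D y -> 0 <= l <= 1 ->
  f (l *: x + (1 - l) *: y) <= l * f x + (1 - l) * f y.

Definition segment_closed D := forall x y (l : R), D x -> D y ->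
  0 <= l <= 1 -> D (l *: x + (1 - l) *: y).

Lemma convex_set_segment D : convex_set D -> segment_closed D.
Proof.
move=> cD x y l Dx Dy /andP[l0 l1].
exact: (set_mem (cD x y (Itv01 l0 l1) (mem_set Dx) (mem_set Dy))).
Qed.

Lemma convex_function_on f : convex_function setT f -> convex_on setT f.
Proof.
move=> cf x y l _ _ /andP[l0 l1].
exact: (cf (Itv01 l0 l1) x y (mem_set I) (mem_set I)).
Qed.

Lemma convex_onD D f h :
  convex_on D f -> convex_on D h -> convex_on D (fun y => f y + h y).
Proof.
move=> cf ch x y l Dx Dy l01.
by have := cf _ _ _ Dx Dy l01; have := ch _ _ _ Dx Dy l01; lra.
Qed.

Lemma convex_onZ D f k :
  0 <= k -> convex_on D f -> convex_on D (fun y => k * f y).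
Proof.
move=> k0 cf x y l Dx Dy l01.
by have := ler_wpM2l k0 (cf _ _ _ Dx Dy l01); lra.
Qed.

Lemma convex_on_sum (I : finType) D (f : I -> 'cV[R]_n -> R) :
  (forall i, convex_on D (f i)) -> convex_on D (fun y => \sum_i f i y).
Proof.
move=> cf x y l Dx Dy l01; rewrite !mulr_sumr -big_split.
by apply: ler_sum => i _; apply: cf.
Qed.

Lemma convex_on_max0 D f :
  convex_on D f -> convex_on D (fun y => Num.max (f y) 0).
Proof.
move=> cf x y l Dx Dy /[dup] l01 /andP[l0 l1].
rewrite ge_max (le_trans (cf _ _ _ Dx Dy l01)) /=.
  by rewrite addr_ge0// mulr_ge0 ?subr_ge0// le_max lexx orbT.
by rewrite lerD// ler_wpM2l ?subr_ge0// le_max lexx.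
Qed.

Lemma convex_on_dotl D v : convex_on D (fun y => dot y v).
Proof. by move=> x y l _ _ _; rewrite dotDl !dotZl. Qed.

End ConvexOn.

(** * Bregman divergences and proximal steps *)

Section Bregman.
Context {R : realType} {n : nat}.
Implicit Types (f : 'cV[R]_n -> R) (z v : 'cV[R]_n).

(** Divide by [s] and let [s] tend to 0 from the right. The slack [s * b'] leaves room for a term of
    second order in [s], such as the one strong convexity produces. *)
Lemma directional_derivative_ge f z v (b b' : R) : differentiable f z ->
  (forall s, 0 < s <= 1 -> s * (b - s * b') <= f (s *: v + z) - f z) ->
  b <= 'd f z v.
Proof.
move=> df H; rewrite -deriveE//.
have dd := cvg_dnbhs_at_right (diff_derivable (v := v) df).
have bb : (b - h * b') @[h --> (0:R)^'+] --> b - 0 * b'.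
  apply: cvg_at_right_filter; apply: cvgB; first exact: cvg_cst.
  by apply: cvgM; [exact: cvg_id | exact: cvg_cst].
rewrite mul0r subr0 in bb; apply: (ler_cvg_to bb dd); near=> s.
have s0 : 0 < s by near: s; exact: nbhs_right_gt.
have s1 : s <= 1 by near: s; exact: nbhs_right_le.
rewrite -[leLHS](mulKf (lt0r_neq0 s0)); apply: ler_wpM2l.
  by rewrite invr_ge0 ltW.
by apply: H; rewrite s0.
Unshelve. all: by end_near. Qed.

Lemma directional_derivative_le f z v (b b' : R) : differentiable f z ->
  (forall s, 0 < s <= 1 -> f (s *: v + z) - f z <= s * (b - s * b')) ->
  'd f z v <= b.
Proof.
move=> df H; rewrite -lerN2.
have -> : - 'd f z v = 'd (- f) z v by rewrite diffN.
apply: (@directional_derivative_ge _ _ _ _ (- b')) => [|s /H h].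
  exact: differentiableN.
by rewrite -[(- f) _]/(- f _) -[(- f) z]/(- f z); lra.
Qed.

(** Strong convexity on the segment from [y] to [x] bounds the increment of [f] by s (f x - f y) - s
    (1 - s) |x - y|^2 / 2; its slope at s = 0 gives the claim. *)
Lemma bregman_ge (D : set 'cV[R]_n) f x y :
  strongly_convex D 1 f -> D x -> D y -> differentiable f y ->
  dot (x - y) (x - y) / 2 <= bregman f x y.
Proof.
move=> cf Dx Dy df; rewrite /bregman lerBrDr -lerBrDl.
apply: (@directional_derivative_le _ _ _ _ (- (dot (x - y) (x - y) / 2))) => //.
move=> s /andP[s0 s1].
have -> : s *: (x - y) + y = s *: x + (1 - s) *: y.
  by rewrite scalerBr scalerBl scale1r -addrA (addrC (- _)).
have := cf x y s Dx Dy; rewrite (ltW s0) s1 sqr_enorm => /(_ isT).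
lra.
Qed.

(** As [phi] may be nonsmooth, optimality of [z] is exploited by comparison with the points of the
    segment towards [u]: convexity handles [phi], and differentiation at s = 0 handles [Reg]. *)
Lemma prox_three_point (D : set 'cV[R]_n) (Reg phi : 'cV[R]_n -> R) z0 z u :
  segment_closed D -> convex_on D phi ->
  differentiable Reg z ->
  is_argmin D (fun y => phi y + bregman Reg y z0) z -> D u ->
  phi z + bregman Reg z z0 + bregman Reg u z <= phi u + bregman Reg u z0.
Proof.
move=> sD cphi df [Dz zmin] Du.
(* First-order optimality in the direction [u - z]; the three-point inequality is a rearrangement of
   it. *)
suff : phi z - phi u + 'd Reg z0 (u - z) <= 'd Reg z (u - z).
  rewrite /bregman; move: ('d Reg z0) ('d Reg z) => d0 d.
  have -> : u - z = (u - z0) - (z - z0) by rewrite opprB addrA subrK.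
  rewrite (linearB d0); move: (d _) (d0 _) (d0 _) => d1 d2 d3; lra.
apply: (@directional_derivative_ge _ _ _ _ 0) => // s /andP[s0 s1].
have e : s *: (u - z) + z = s *: u + (1 - s) *: z.
  by rewrite scalerBr scalerBl scale1r -addrA (addrC (- _)).
have s01 : 0 <= s <= 1 by rewrite (ltW s0).
have := zmin _ (sD _ _ _ Du Dz s01); have := cphi _ _ _ Du Dz s01.
rewrite -e /bregman; move: ('d Reg z0) => d0.
have -> : d0 (s *: (u - z) + z - z0) = s * d0 (u - z) + d0 (z - z0).
  by rewrite -addrA (linearD d0) (linearZ_LR d0).
move: (d0 _) (d0 _) => d1 d2; lra.
Qed.

End Bregman.

(** * Existence of subgradients *)

Section Subgradient.
Context {R : realType} {n : nat}.
Implicit Types (f : 'cV[R]_n -> R) (s x y : 'cV[R]_n).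

(* The inductive step of the Hahn-Banach theorem: a linear minorant of [f] on
   the span of the first [k] coordinate vectors extends to the next one. The
   admissible slopes along the new vector are those lying above all the
   quotients in [A] and below all the quotients taken on the other side. *)
Lemma linear_minorant_extend f (k : 'I_n) s :
  convex_on setT f ->
  (forall y, (forall i : 'I_n, (k <= i)%N -> y i 0 = 0) -> dot s y <= f y) ->
  exists s', forall y, (forall i : 'I_n, (k < i)%N -> y i 0 = 0) ->
    dot s' y <= f y.
Proof.
move=> cf sf.
pose V y := forall i : 'I_n, (k <= i)%N -> y i 0 = 0.
pose e : 'cV[R]_n := delta_mx k 0.
have cross y y' t r : V y -> V y' -> 0 < t -> 0 < r ->
    (dot s y' - f (y' - t *: e)) / t <= (f (y + r *: e) - dot s y) / r.
  move=> Vy Vy' t0 r0; rewrite ler_pdivrMr// mulrAC ler_pdivlMr//.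
  have tr0 : 0 < t + r by rewrite addr_gt0.
  (* With this weight the [e] components of the two points cancel, so their convex combination lies
     in the span, where [sf] applies. *)
  pose l := t / (t + r).
  have lE : l * (t + r) = t by rewrite /l divfK ?gt_eqF.
  have l01 : 0 <= l <= 1.
    by rewrite /l divr_ge0 ?(ltW tr0) ?(ltW t0)//= ler_pdivrMr// mul1r lerDl ltW.
  have := cf (y + r *: e) (y' - t *: e) l I I l01.
  have -> : l *: (y + r *: e) + (1 - l) *: (y' - t *: e) = l *: y + (1 - l) *: y'.
    rewrite !scalerDr addrACA scalerN !scalerA -scalerBl.
    have -> : l * r - (1 - l) * t = l * (t + r) - t by ring.
    by rewrite lE subrr scale0r addr0.
  move: (sf (l *: y + (1 - l) *: y')).
  rewrite dotDr !dotZr => h1 h2.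
  have {}h1 := le_trans (h1 _) h2.
  have {}h1 : (l * dot s y + (1 - l) * dot s y') * (t + r) <=
     (l * f (y + r *: e) + (1 - l) * f (y' - t *: e)) * (t + r).
    apply: ler_wpM2r; first exact: ltW.
    by apply: h1 => i ki; rewrite !mxE (Vy _ ki) (Vy' _ ki); lra.
  have wE a b : (l * a + (1 - l) * b) * (t + r) = t * a + r * b.
    have rE : (1 - l) * (t + r) = r by rewrite mulrBl mul1r lE addrAC subrr add0r.
    rewrite -[X in _ = X * a + _]lE -[X in _ = _ + X * b]rE; ring.
  by move: h1; rewrite !wE; lra.
pose A := [set a | exists y t, [/\ V y, 0 < t & a = (dot s y - f (y - t *: e)) / t]].
have V0 : V 0 by move=> i _; rewrite mxE.
have A0 : A !=set0 by exists ((dot s 0 - f (0 - 1 *: e)) / 1), 0, 1.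
have ubA y r : V y -> 0 < r -> ubound A ((f (y + r *: e) - dot s y) / r).
  by move=> Vy r0 _ [y' [t [Vy' t0 ->]]]; apply: cross.
have supA y t : V y -> 0 < t -> (dot s y - f (y - t *: e)) / t <= sup A.
  move=> Vy t0; apply: ub_le_sup; last by exists y, t.
  by exists ((f (0 + 1 *: e) - dot s 0) / 1); apply: ubA.
(* Only coordinate [k] of [s] changes: it becomes the slope [sup A]. *)
exists (s + (sup A - s k 0) *: e) => w Vw.
set r := w k 0; pose y := w - r *: e.
have wE : w = y + r *: e by rewrite /y subrK.
have Vy : V y.
  move=> i; rewrite leq_eqVlt => /predU1P[ki|ki].
    by have <- : k = i by [apply: val_inj]; rewrite !mxE !eqxx mulr1 subrr.
  rewrite !mxE (Vw i ki) (_ : (i == k) = false) ?mulr0 ?subr0//.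
  by rewrite -val_eqE/= gtn_eqF.
have de v : dot e v = v k 0.
  rewrite /dot (bigD1 k)//= big1 ?addr0 => [|i ik].
    by rewrite mxE !eqxx mul1r.
  by rewrite mxE (negPf ik) mul0r.
have -> : dot (s + (sup A - s k 0) *: e) w = dot s y + sup A * r.
  by rewrite dotDl dotZl de {1}wE dotDr dotZr (dotC s e) de -/r; ring.
rewrite [in leRHS]wE.
(* For r > 0 the slope lies below an upper bound of [A]; for r < 0 it lies above an element of
   [A]. *)
have [r0|r0|r0] := ltgtP 0 r.
- have := ge_sup A0 (ubA _ _ Vy r0); rewrite ler_pdivlMr//; lra.
- have := supA y (- r) Vy; rewrite oppr_gt0 => /(_ r0).
  by rewrite ler_pdivrMr ?oppr_gt0// scaleNr opprK; lra.
- by rewrite -r0 mulr0 scale0r !addr0; apply: sf.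
Qed.

(** Induction on the number of coordinates allowed to be nonzero; [0 <= f 0] is the base case. *)
Lemma linear_minorant f : convex_on setT f -> 0 <= f 0 ->
  exists s, forall y, dot s y <= f y.
Proof.
move=> cf f0.
suff H k : (k <= n)%N -> exists s, forall y,
    (forall i : 'I_n, (k <= i)%N -> y i 0 = 0) -> dot s y <= f y.
  have [s sf] := H n (leqnn n); exists s => y; apply: sf => i.
  by rewrite leqNgt ltn_ord.
elim: k => [_|k IH kn].
  exists 0 => y y0; have -> : y = 0 by apply/colP => i; rewrite y0// mxE.
  by rewrite dot0r.
have [s sf] := IH (ltnW kn).
exact: (linear_minorant_extend (k := Ordinal kn) cf sf).
Qed.

Lemma subgradient_exists f x : convex_on setT f -> exists s, subgradient f x s.
Proof.
move=> cf.
have [||s sf] := @linear_minorant (fun y => f (x + y) - f x).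
- move=> y y' l _ _ l01; have := cf (x + y) (x + y') l I I l01.
  rewrite !scalerDr addrACA -scalerDl (addrC l) subrK scale1r; lra.
- by rewrite addr0 subrr.
by exists s => y; have := sf (y - x); rewrite addrCA subrr addr0; lra.
Qed.

(** The standing assumption bounds [opnorm] of every matrix of subgradients, which has force only
    once such a matrix exists. *)
Lemma subgradient_mx_exists m (g : 'cV[R]_n -> 'cV[R]_m) x :
  (forall j, convex_on setT (fun y => g y j 0)) ->
  exists A, subgradient_mx g x A.
Proof.
move=> cg.
have /choice[s sP] j := subgradient_exists x (cg j).
exists (\matrix_(j, i) s j i 0) => j.
by have -> : (row j (\matrix_(j, i) s j i 0))^T = s j by
  apply/colP => i; rewrite !mxE.
Qed.

End Subgradient.

(** * Operator norm and drift of the constraint violation *)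

Section Constraint.
Context {R : realType} {n m : nat}.
Implicit Types (A : 'M[R]_(m, n)) (v x z : 'cV[R]_n).

Lemma mulmx_dot A v j : (A *m v) j 0 = dot (row j A)^T v.
Proof. by rewrite mxE; apply: eq_bigr => i _; rewrite !mxE. Qed.

Lemma opnorm_le A v : enorm v <= 1 -> enorm (A *m v) <= opnorm A.
Proof.
move=> v1; apply: ub_le_sup; last by exists v.
(* [opnorm] is a [sup], so its set must be shown bounded. Row by row, |<a, w>| <= (|a|^2 + 1) / 2
   when |w| <= 1. *)
exists (Num.sqrt (\sum_j ((dot (row j A)^T (row j A)^T + 1) / 2) ^+ 2)).
move=> _ [w /= w1 <-]; rewrite ler_wsqrtr//; apply: ler_sum => j _.
rewrite -expr2 -[leLHS]real_normK ?num_real//.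
set b := dot _ _.
have {}w1 : dot w w <= 1 by rewrite -(expr1n _ 2); apply: enorm_le.
have b0 : 0 <= b by apply: dotvv_ge0.
rewrite ler_sqr ?nnegrE ?normr_ge0//; last by rewrite divr_ge0// addr_ge0.
rewrite mulmx_dot; set d := dot _ w.
have h1 : 2 * d <= b + dot w w by exact: le2_dot.
have h2 : 2 * - d <= b + dot w w.
  have := le2_dot (row j A)^T (- w).
  by rewrite -scaleN1r !dotZr dotZl !mulN1r opprK.
by rewrite ler_norml; apply/andP; split; lra.
Qed.

Lemma dot_mulmx_le A v (G : R) : opnorm A <= G ->
  dot (A *m v) (A *m v) <= G ^+ 2 * dot v v.
Proof.
move=> AG; have := dotvv_ge0 v; rewrite le0r => /orP[/eqP v0|v0].
  by rewrite (dotvv0_eq0 v0) mulmx0 !dot0r mulr0.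
pose r := enorm v; have r2 : r ^+ 2 = dot v v by exact: sqr_enorm.
have r0 : r != 0 by apply/eqP => h; move: v0; rewrite -r2 h expr0n ltxx.
have w1 : enorm (r^-1 *: v) <= 1.
  by rewrite /enorm dotZr dotZl -r2 mulrA -expr2 -exprMn mulVf// expr1n sqrtr1.
have := enorm_le (le_trans (opnorm_le A w1) AG).
rewrite -scalemxAr dotZr dotZl mulrA -expr2 exprVn r2 mulrC.
by rewrite ler_pdivrMr.
Qed.

Lemma pospart_ge0 (v : 'cV[R]_m) i : 0 <= pospart v i 0.
Proof. by rewrite mxE le_max lexx orbT. Qed.

Lemma dot_pospart_le (v : 'cV[R]_m) : dot (pospart v) (pospart v) <= dot v v.
Proof.
apply: ler_sum => i _; rewrite mxE /Num.max.
by case: ltP => // _; rewrite mul0r -expr2 sqr_ge0.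
Qed.

(* Where [pospart (g x)] exceeds [pospart (g z)], the excess is at most the
   entry of [A *m (x - z)]; elsewhere nothing is needed. Using the one matrix
   [A] keeps the constant [G ^+ 2], which the proximal term only just absorbs;
   treating the two signs with subgradients at [x] and at [z] would double it. *)
Lemma dot_pospart_drift (g : 'cV[R]_n -> 'cV[R]_m) A x z (G : R) :
  subgradient_mx g x A -> opnorm A <= G ->
  dot (pospart (g x)) (pospart (g x)) <=
    2 * dot (pospart (g z)) (pospart (g x)) + G ^+ 2 * dot (x - z) (x - z).
Proof.
move=> sA AG.
apply: le_trans (lerD (lexx _) (dot_mulmx_le (x - z) AG)).
rewrite mulr_sumr -big_split; apply: ler_sum => j _ /=.
rewrite mulmx_dot !mxE.
have := sA j z; rewrite -[z - x]opprB -scaleN1r dotZr mulN1r /=.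
move: (g x j 0) (g z j 0) (dot _ _) => a b d h.
have d0 : 0 <= d * d by rewrite -expr2 sqr_ge0.
rewrite /Num.max; case: (ltP a 0) => ha; first by rewrite !mulr0 add0r.
case: (ltP b 0) => hb.
  have ad : a <= d by lra.
  by rewrite mul0r mulr0 add0r ler_pM.
(* If a <= b then a^2 <= a b. Otherwise a^2 = 2 a b + (a - b)^2 - b^2, with 0 <= a - b <= d. *)
have [ab|/ltW ba] := leP a b; first by have := ler_wpM2r ha ab; nra.
have abd : a - b <= d by lra.
have ab0 : 0 <= a - b by rewrite subr_ge0.
have := ler_pM ab0 ab0 abd abd; nra.
Qed.

Lemma convex_on_dot_pospart (D : set 'cV[R]_n) (g : 'cV[R]_n -> 'cV[R]_m)
    (q : 'cV[R]_m) :
  (forall i, 0 <= q i 0) -> (forall j, convex_on D (fun y => g y j 0)) ->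
  convex_on D (fun y => dot q (pospart (g y))).
Proof.
move=> q0 cg; apply: convex_on_sum => j; apply: convex_onZ => //.
by move=> x y l Dx Dy l01; rewrite !mxE; exact: (convex_on_max0 (cg j)).
Qed.

End Constraint.

(** * Inequalities for a single round *)

Section Rounds.
Context {R : realType} {p m : nat}.
Implicit Types (X : set 'cV[R]_p) (Reg : 'cV[R]_p -> R).

Lemma round_bound X Reg (g : 'cV[R]_p -> 'cV[R]_m) (A : 'M[R]_(m, p))
    (c h z x z' u : 'cV[R]_p) (q q' qh : 'cV[R]_m) (eta gamma G : R) :
  segment_closed X -> (forall y, X y -> differentiable Reg y) ->
  strongly_convex X 1 Reg -> (forall j, convex_on X (fun y => g y j 0)) ->
  subgradient_mx g x A -> opnorm A <= G ->
  0 < eta -> 0 < gamma -> eta * gamma ^+ 2 * G ^+ 2 = 1 ->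
  X z -> X u -> (forall j, g u j 0 <= 0) -> (forall j, 0 <= q j 0) ->
  qh = q + gamma *: pospart (g z) ->
  is_argmin X (fun y => eta * dot y h + eta * gamma * dot qh (pospart (g y))
                 + bregman Reg y z) x ->
  is_argmin X (fun y => eta * dot y c + eta * gamma * dot qh (pospart (g y))
                 + bregman Reg y z) z' ->
  q' = q + gamma *: pospart (g x) ->
  eta * (dot c x - dot c u) + eta / 2 * (dot q' q' - dot q q) <=
    bregman Reg u z - bregman Reg u z' + eta ^+ 2 / 2 * dot (c - h) (c - h).
Proof.
move=> sX dReg cReg cg sA AG eta0 gamma0 egG Xz Xu gu q0 qhE xmin zmin q'E.
have qh0 j : 0 <= qh j 0.
  by rewrite qhE mxE [in X in _ + X]mxE addr_ge0// mulr_ge0 ?pospart_ge0// ltW.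
have cphi v : convex_on X (fun y => eta * dot y v +
    eta * gamma * dot qh (pospart (g y))).
  apply: convex_onD; apply: convex_onZ; rewrite ?mulr_ge0 ?(ltW eta0) ?(ltW gamma0)//.
    exact: convex_on_dotl.
  exact: convex_on_dot_pospart.
have [Xx _] := xmin; have [Xz' _] := zmin.
(* The update [z'] is compared with [u], and the play [x] with [z'], so the divergence of [z'] from
   [z] cancels in the sum. *)
have P1 := prox_three_point sX (cphi c) (dReg _ Xz') zmin Xu.
have P2 := prox_three_point sX (cphi h) (dReg _ Xx) xmin Xz'.
have gu0 : pospart (g u) = 0 by apply/colP => j; rewrite !mxE; apply/max_idPr.
have B1 := bregman_ge cReg Xx Xz (dReg _ Xz).
have B2 := bregman_ge cReg Xz' Xx (dReg _ Xx).
(* Young's inequality for the prediction error: the |z' - x|^2 it creates is absorbed by [B2]. *)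
have Y := le2_dot (- eta *: (c - h)) (z' - x).
(* The choice of [gamma] turns the drift into exactly |x - z|^2; half of it is absorbed by [B1]. *)
have D : eta * gamma ^+ 2 * dot (pospart (g x)) (pospart (g x)) <=
    2 * (eta * gamma ^+ 2 * dot (pospart (g z)) (pospart (g x))) +
    dot (x - z) (x - z).
  have e0 : 0 <= eta * gamma ^+ 2 by rewrite mulr_ge0 ?sqr_ge0 ?(ltW eta0).
  have := ler_wpM2l e0 (dot_pospart_drift z sA AG).
  by rewrite mulrDr [X in _ <= _ + X]mulrA egG mul1r [X in _ <= X + _]mulrCA.
have qhx : dot qh (pospart (g x)) =
    dot q (pospart (g x)) + gamma * dot (pospart (g z)) (pospart (g x)).
  by rewrite qhE dotDl dotZl.
have qq : dot q' q' = dot q q + 2 * gamma * dot q (pospart (g x)) +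
    gamma ^+ 2 * dot (pospart (g x)) (pospart (g x)).
  by rewrite q'E dotDl !dotDr !dotZl !dotZr (dotC _ q); ring.
rewrite qq; move: P1 P2 B1 B2 Y D; rewrite gu0 dot0r qhx.
rewrite dotZl dotZr dotZl; move: (dot (c - h) (c - h)) => N.
rewrite [dot (c - h) _]dotBl !(dotBr _ z' x) !(dotC c) !(dotC h).
move: (dot (x - z) _) (dot (z' - x) _) (dot (pospart (g x)) _).
move: (dot (pospart (g z)) _) (dot q (pospart _)) (dot qh _) (dot q q).
move: (bregman Reg z' z) (bregman Reg u z') (bregman Reg u z).
move: (bregman Reg z' x) (bregman Reg x z).
move: (dot z' c) (dot z' h) (dot x c) (dot x h) (dot u c).
move=> *; lra.
Qed.

Lemma first_round_bound X Reg (g : 'cV[R]_p -> 'cV[R]_m)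
    (c z z' u : 'cV[R]_p) (q' qh : 'cV[R]_m) (eta gamma G F : R) :
  segment_closed X -> (forall y, X y -> differentiable Reg y) ->
  strongly_convex X 1 Reg -> (forall j, convex_on X (fun y => g y j 0)) ->
  0 < eta -> 0 < gamma -> eta * gamma ^+ 2 * G ^+ 2 = 1 -> 0 < G ->
  X z -> X u -> (forall j, g u j 0 <= 0) -> (forall j, 0 <= qh j 0) ->
  (forall y, X y -> `|dot c y| <= F) -> enorm (g z) <= F ->
  is_argmin X (fun y => eta * dot y c + eta * gamma * dot qh (pospart (g y))
                 + bregman Reg y z) z' ->
  q' = gamma *: pospart (g z) ->
  eta * (dot c z - dot c u) + eta / 2 * dot q' q' <=
    bregman Reg u z - bregman Reg u z' + 2 * F * eta + F ^+ 2 / (2 * G ^+ 2).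
Proof.
move=> sX dReg cReg cg eta0 gamma0 egG G0 Xz Xu gu qh0 cF gF zmin q'E.
have [Xz' _] := zmin.
have cphi : convex_on X (fun y => eta * dot y c +
    eta * gamma * dot qh (pospart (g y))).
  apply: convex_onD; apply: convex_onZ; rewrite ?mulr_ge0 ?(ltW eta0) ?(ltW gamma0)//.
    exact: convex_on_dotl.
  exact: convex_on_dot_pospart.
have P := prox_three_point sX cphi (dReg _ Xz') zmin Xu.
have gu0 : pospart (g u) = 0 by apply/colP => j; rewrite !mxE; apply/max_idPr.
have B := le_trans (divr_ge0 (dotvv_ge0 _) (ler0n _ _))
  (bregman_ge cReg Xz' Xz (dReg _ Xz)).
have Q : 0 <= eta * gamma * dot qh (pospart (g z')).
  rewrite !mulr_ge0 ?(ltW eta0) ?(ltW gamma0)// dot_ge0// => j.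
  exact: pospart_ge0.
(* No hint governs this round, so moving from [z] to [z'] is paid for by the cost bound [F]. *)
have c1 : eta * (dot c z - dot c z') <= 2 * F * eta.
  rewrite mulrC ler_pM2r//.
  by have := cF _ Xz; have := cF _ Xz'; rewrite !ler_norml; lra.
have c2 : eta / 2 * dot q' q' <= F ^+ 2 / (2 * G ^+ 2).
  have -> : F ^+ 2 / (2 * G ^+ 2) = eta * gamma ^+ 2 / 2 * F ^+ 2.
    have <- : eta * gamma ^+ 2 * G ^+ 2 / G ^+ 2 = eta * gamma ^+ 2.
      by rewrite mulfK// expf_neq0// gt_eqF.
    by rewrite egG; field; rewrite gt_eqF.
  rewrite q'E dotZl dotZr.
  have -> : forall d, eta / 2 * (gamma * (gamma * d)) = eta * gamma ^+ 2 / 2 * d.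
    by move=> d; ring.
  apply: ler_wpM2l; first by rewrite divr_ge0// mulr_ge0 ?sqr_ge0 ?(ltW eta0).
  exact: le_trans (dot_pospart_le _) (enorm_le gF).
move: P B Q c1; rewrite gu0 dot0r !(dotC c); move: c2.
move: (dot q' q') (dot z c) (dot z' c) (dot u c) (dot qh _) (F ^+ 2 / _).
move: (bregman Reg z' z) (bregman Reg u z') (bregman Reg u z).
move=> *; lra.
Qed.

End Rounds.

(** * Summation over a run *)

Section Run.
Context {R : realType} {p m : nat} (T : nat) (X : set 'cV[R]_p).
Context (Reg : 'cV[R]_p -> R) (eta gamma : R) (cost hint : nat -> 'cV[R]_p).
Context (g : nat -> 'cV[R]_p -> 'cV[R]_m) (x z : nat -> 'cV[R]_p).
Context (q qh : nat -> 'cV[R]_m).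

Lemma run_z_in : algorithm_run T X Reg (fun=> eta) (fun=> gamma)
    cost hint g x z q qh ->
  forall t, (1 <= t <= T.+1)%N -> X (z t).
Proof.
move=> run [//|[_|t tT]]; first by case: (run_z1 run).
by have [] := run_z run (t := t.+1) tT.
Qed.

Lemma run_x_in : algorithm_run T X Reg (fun=> eta) (fun=> gamma)
    cost hint g x z q qh ->
  forall t, (1 <= t <= T)%N -> X (x t).
Proof.
move=> run [//|[_|t tT]]; first by rewrite (run_x1 run); case: (run_z1 run).
by have [] := run_x run (t := t.+1) tT.
Qed.

Lemma run_q_ge0 : 0 <= gamma -> algorithm_run T X Reg (fun=> eta) (fun=> gamma)
    cost hint g x z q qh ->
  forall t, (t <= T)%N -> forall j, 0 <= q t j 0.
Proof.
move=> gamma0 run; elim=> [_ j|t IH tT j]; first by rewrite (run_q0 run) mxE.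
rewrite (run_q run (t := t.+1) tT) mxE [in X in _ + X]mxE.
by rewrite addr_ge0 ?IH 1?ltnW// mulr_ge0// pospart_ge0.
Qed.

Lemma run_qhE : algorithm_run T X Reg (fun=> eta) (fun=> gamma)
    cost hint g x z q qh ->
  forall t, (t < T)%N -> qh t = q t + gamma *: pospart (g t.+1 (z t.+1)).
Proof. by move=> run [|t] tT; [exact: run_qh0 run | exact: (run_qh run (t := t.+1) tT)]. Qed.

(** Each round adds its violations, scaled by [gamma], to the queue; a bound on [q T] thus controls
    the total violation. *)
Lemma run_sum_q : algorithm_run T X Reg (fun=> eta) (fun=> gamma)
    cost hint g x z q qh ->
  forall k, (k <= T)%N -> \sum_j q k j 0 = gamma * violation k g x.
Proof.
move=> run; elim=> [_|k IH kT].
  rewrite (run_q0 run) /violation big_geq// mulr0.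
  by apply: big1 => j _; rewrite mxE.
rewrite /violation big_nat_recr//= mulrDr -[in RHS]/(violation k g x).
rewrite -IH ?(ltnW kT)// mulr_sumr -big_split; apply: eq_bigr => j _ /=.
by rewrite (run_q run (t := k.+1) kT) !mxE.
Qed.

Lemma run_bound (G F delta : R) (u : 'cV[R]_p) :
  (forall y, X y -> differentiable Reg y) -> strongly_convex X 1 Reg ->
  0 < eta -> 0 < gamma -> 0 < G -> eta * gamma ^+ 2 * G ^+ 2 = 1 ->
  standing_assumptions T X cost g G F ->
  algorithm_run T X Reg (fun=> eta) (fun=> gamma) cost hint g x z q qh ->
  (forall t, (1 <= t <= T)%N -> enorm (cost t - hint t) <= delta) ->
  feasible T X g u -> (0 < T)%N ->
  eta * regret T cost x u + eta / 2 * dot (q T) (q T) <=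
    bregman Reg u (x 1%N) + 2 * F * eta + F ^+ 2 / (2 * G ^+ 2) +
    T%:R * (eta ^+ 2 / 2 * delta ^+ 2).
Proof.
move=> dReg cReg eta0 gamma0 G0 egG sa run hd [Xu gu] T0.
have sX := convex_set_segment (sa_convex sa).
have cg t j (tT : (1 <= t <= T)%N) : convex_on setT (fun y => g t y j 0).
  exact: convex_function_on (sa_constraint_convex sa j tT).
have cgX t j (tT : (1 <= t <= T)%N) : convex_on X (fun y => g t y j 0).
  by move=> y y' l _ _; apply: cg.
have gu0 t j (tT : (1 <= t <= T)%N) : g t u j 0 <= 0 by exact: gu.
have Xz := run_z_in run; have Xx := run_x_in run.
have qE t (tT : (1 <= t <= T)%N) := run_q run tT.
have q0 := run_q_ge0 (ltW gamma0) run.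
have d0 : 0 <= eta ^+ 2 / 2 * delta ^+ 2.
  by apply: mulr_ge0; rewrite ?sqr_ge0// divr_ge0 ?sqr_ge0.
(* The divergence from [z k.+1] is kept so that the sum telescopes, and dropped at k = T as
   nonnegative. The induction starts at k = 1, the exceptional round. *)
suff H k : (0 < k <= T)%N ->
    eta * regret k cost x u + eta / 2 * dot (q k) (q k) <=
    bregman Reg u (x 1%N) - bregman Reg u (z k.+1) + 2 * F * eta +
    F ^+ 2 / (2 * G ^+ 2) + k%:R * (eta ^+ 2 / 2 * delta ^+ 2).
  have XzT : X (z T.+1) by apply: Xz; rewrite /= leqnn.
  have B := le_trans (divr_ge0 (dotvv_ge0 _) (ler0n _ _))
    (bregman_ge cReg Xu XzT (dReg _ XzT)).
  have := H T; rewrite T0 leqnn => /(_ isT); lra.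
have regretS i : regret i.+1 cost x u =
    regret i cost x u + (dot (cost i.+1) (x i.+1) - dot (cost i.+1) u).
  by rewrite /regret /total_cost !(big_nat_recr i.+1)//=; ring.
elim: k => // -[_ T1|k IH kT].
  have z1 : x 1%N = z 1%N := run_x1 run.
  have Xz1 : X (z 1%N) by apply: Xz.
  have qh0 j : 0 <= qh 0%N j 0.
    rewrite (run_qhE run T0) mxE [in X in _ + X]mxE.
    rewrite addr_ge0 ?q0// mulr_ge0 ?pospart_ge0//; exact: ltW.
  have q1 : q 1%N = gamma *: pospart (g 1%N (z 1%N)).
    by rewrite (qE _ T1) (run_q0 run) add0r z1.
  have /= := first_round_bound sX dReg cReg (cgX _ ^~ T1) eta0 gamma0 egG G0 Xz1 Xu
    (gu0 _ ^~ T1) qh0 (fun y => sa_cost_bound sa (y := y) T1) (sa_constraint_bound sa T1 Xz1)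
    (run_z run T1) q1.
  rewrite regretS {1}/regret /total_cost !big_geq// subrr add0r mul1r z1; lra.
have {}IH := IH (ltnW kT).
have k2T : (1 <= k.+2 <= T)%N := kT.
have Xx2 := Xx _ k2T.
have [A sA] := subgradient_mx_exists (x k.+2) (cg _ ^~ k2T).
have Xz2 : X (z k.+2) by apply: Xz; rewrite /= ltnW// ltnS.
have := round_bound sX dReg cReg (cgX _ ^~ k2T) sA
  (sa_constraint_subgradient sa k2T Xx2 sA) eta0 gamma0 egG Xz2 Xu
  (gu0 _ ^~ k2T) (q0 _ (ltnW kT)) (run_qhE run kT) (run_x run (t := k.+1) kT)
  (run_z run k2T) (qE _ k2T).
have dd : eta ^+ 2 / 2 * dot (cost k.+2 - hint k.+2) (cost k.+2 - hint k.+2)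
    <= eta ^+ 2 / 2 * delta ^+ 2.
  apply: ler_wpM2l; first by rewrite divr_ge0 ?sqr_ge0.
  by apply: enorm_le; apply: hd.
rewrite [in X in _ -> X]regretS -[k.+2%:R]natr1 /=.
move: IH dd; move: (eta ^+ 2 / 2 * _) (eta ^+ 2 / 2 * _) => N1 N2 IH dd RB; lra.
Qed.

End Run.

(** * Rates in [T] *)

(** Entrywise 2 v <= s + v^2 / s. The scale [s] is free, to be balanced against the size of
    [dot v v]. *)
Lemma sum_le_dot (R : realType) m (v : 'cV[R]_m) (s : R) : 0 < s ->
  2 * \sum_j v j 0 <= m%:R * s + dot v v / s.
Proof.
move=> s0; rewrite mulr_sumr mulr_suml.
have -> : m%:R * s = \sum_(j < m) s by rewrite sumr_const card_ord mulr_natl.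
rewrite -big_split; apply: ler_sum => j _ /=.
rewrite -subr_ge0.
have -> : s + v j 0 * v j 0 / s - 2 * v j 0 = (s - v j 0) ^+ 2 / s.
  by field; rewrite gt_eqF.
by rewrite divr_ge0 ?sqr_ge0// ltW.
Qed.

(* The hidden constant depends on the comparator u only through its divergence
   from the starting point, and monotonically so. *)
Theorem theorem2 (R : realType) (p m : nat)
    (X : set 'cV[R]_p) (Reg : 'cV[R]_p -> R) (a c G F H : R)
    (hc : 0 < c < 1) (ha : 0 <= a < 1) (hG : 0 < G)
    (hReg_diff : forall y, X y -> differentiable Reg y)
    (hReg_convex : strongly_convex X 1 Reg) :
  exists2 C : R -> R, {homo C : r s / r <= s} &
    forall (T : nat) (cost hint : nat -> 'cV[R]_p)
      (g : nat -> 'cV[R]_p -> 'cV[R]_m)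
      (x z : nat -> 'cV[R]_p) (q qh : nat -> 'cV[R]_m) (u : 'cV[R]_p),
    let eta := (T%:R `^ c)^-1 in
    let gamma := (G * Num.sqrt eta)^-1 in
    let K := C (bregman Reg u (x 1%N)) in
    (0 < T)%N ->
    standing_assumptions T X cost g G F ->
    algorithm_run T X Reg (fun=> eta) (fun=> gamma) cost hint g x z q qh ->
    (forall t, (1 <= t <= T)%N ->
      enorm (cost t - hint t) <= H * T%:R `^ (- a / 2)) ->
    is_best_feasible T X cost g u ->
    regret T cost x u <= K * T%:R `^ Num.max (1 - a - c) c /\
    violation T g x <= K * T%:R `^ (1 / 2 - c / 2).
Proof.
case/andP: hc => c0 c1; case/andP: ha => a0 a1.
(* The constants left once [run_bound] is divided by [eta]: two from the first round, one from the
   prediction errors. *)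
pose L := 2 * F + F ^+ 2 / (2 * G ^+ 2) + H ^+ 2 / 2.
(* The first summand serves the regret and the second the violation; both are nonnegative at the
   divergence of [u], so the sum serves both. *)
exists (fun r => (r + L) + G * (m%:R + 2 * (r + L + 2 * F)) / 2).
  by move=> r s rs; nra.
move=> T cost hint g x z q qh u eta gamma K T0 sa run hd [fu _].
have T1 : 1 <= T%:R :> R by rewrite ler1n.
have Tp : 0 < T%:R :> R by rewrite ltr0n.
have powD (r s : R) : T%:R `^ (r + s) = T%:R `^ r * T%:R `^ s.
  by rewrite powRD// (gt_eqF Tp) implybT.
have pow0 (r : R) : 0 < T%:R `^ r by rewrite powR_gt0.
pose P := T%:R `^ c; set M := T%:R `^ Num.max (1 - a - c) c.
have etaE : eta = P^-1 by [].
have eta0 : 0 < eta by rewrite invr_gt0 pow0.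
have gamma0 : 0 < gamma by rewrite invr_gt0 mulr_gt0// sqrtr_gt0.
have egG : eta * gamma ^+ 2 * G ^+ 2 = 1.
  rewrite /gamma exprVn exprMn sqr_sqrtr ?ltW//.
  have Gn0 : G != 0 by rewrite gt_eqF.
  have en0 : eta != 0 by rewrite gt_eqF.
  by field; rewrite Gn0 en0.
have X1 : X (x 1%N) by apply: (run_x_in run); rewrite T0.
have F0 : 0 <= F.
  exact: le_trans (enorm_ge0 _) (sa_constraint_bound sa (t := 1%N) T0 X1).
have [Xu gu] := fu.
have B0 : 0 <= bregman Reg u (x 1%N).
  apply: le_trans (bregman_ge hReg_convex Xu X1 (hReg_diff _ X1)).
  by rewrite divr_ge0 ?dotvv_ge0.
have main := run_bound hReg_diff hReg_convex eta0 gamma0 hG egG sa run hd fu T0.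
set B := bregman Reg u _ in main B0 K *; set S := dot (q T) _ in main.
clearbody B; have S0 : 0 <= S by exact: dotvv_ge0.
have PM : P <= M by rewrite ler_powR// le_max lexx orbT.
have QM : T%:R `^ (1 - a - c) <= M by rewrite ler_powR// le_max lexx.
have M1 : 1 <= M by rewrite -(powRr0 T%:R) ler_powR// le_max (ltW c0) orbT.
have MT : M <= T%:R.
  by rewrite -[leRHS]powRr1 ?ler0n// ler_powR// ge_max; apply/andP; split; lra.
have W0 : 0 <= F ^+ 2 / (2 * G ^+ 2).
  by rewrite divr_ge0 ?sqr_ge0// mulr_ge0 ?sqr_ge0.
have H0 : 0 <= H ^+ 2 / 2 by rewrite divr_ge0 ?sqr_ge0.
have {main}main : regret T cost x u + S / 2 <= (B + L) * M.
  have PV : P * eta = 1 by rewrite mulfV ?gt_eqF ?pow0.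
  have := ler_wpM2l (ltW (pow0 c)) main; rewrite -/P => h.
  have E1 : P * (eta * regret T cost x u + eta / 2 * S) =
      P * eta * (regret T cost x u + S / 2) by ring.
  (* The accumulated prediction error, of order eta T T^(-a), is where the exponent 1 - a - c
     arises. *)
  have E2 : P * (T%:R * (eta ^+ 2 / 2 * (H * T%:R `^ (- a / 2)) ^+ 2)) =
      H ^+ 2 / 2 * T%:R `^ (1 - a - c).
    have -> : T%:R `^ (1 - a - c) = T%:R * T%:R `^ (- a / 2) ^+ 2 * eta.
      rewrite powD (powD 1) powRr1 ?ler0n// (powRN _ c) -/P; congr (_ * _ * _).
      by rewrite expr2 -powD; congr (_ `^ _); lra.
    transitivity (P * eta * (H ^+ 2 / 2 * (T%:R * T%:R `^ (- a / 2) ^+ 2 * eta))).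
      by ring.
    by rewrite PV mul1r.
  have E3 : P * (2 * F * eta) = 2 * F * (P * eta) by ring.
  move: h; rewrite E1 !(mulrDr P) E2 E3 PV mul1r => /le_trans; apply.
  have := ler_wpM2l B0 PM; have := ler_wpM2l W0 PM; have := ler_wpM2l H0 QM.
  have := ler_wpM2l F0 M1; rewrite /L; lra.
have L0 : 0 <= L by rewrite /L; lra.
have BL0 : 0 <= B + L by rewrite addr_ge0.
pose V := G * (m%:R + 2 * (B + L + 2 * F)) / 2.
have V0 : 0 <= V.
  apply: divr_ge0 => //; apply: mulr_ge0; first exact: ltW.
  by have := ler0n R m; lra.
have KE : K = (B + L) + V by [].
split.
  have M0 : 0 <= M by rewrite (le_trans ler01).
  have := mulr_ge0 V0 M0; have := S0; rewrite KE [_ * M]mulrDl; lra.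
(* The regret may be very negative, so [main] bounds the squared queue norm [S] only by a multiple
   of T. *)
have negR : - regret T cost x u <= 2 * F * T%:R.
  rewrite /regret /total_cost -sumrB -sumrN mulr_natr.
  have -> : 2 * F *+ T = \sum_(1 <= t < T.+1) (2 * F).
    by rewrite sumr_const_nat subSS subn0.
  apply: ler_sum_nat => t tT.
  have := sa_cost_bound sa tT Xu; have := sa_cost_bound sa tT (run_x_in run tT).
  by rewrite !ler_norml; lra.
have ST : S <= 2 * (B + L + 2 * F) * T%:R.
  by have := ler_wpM2l BL0 MT; lra.
(* As [S] is of order T, this scale makes both terms of [sum_le_dot] of order T^(1/2); the factor 1
   / gamma then contributes T^(-c/2). *)
pose s : R := T%:R `^ (1 / 2).
have s2 : s * s = T%:R.
  by rewrite -powD -[RHS]powRr1 ?ler0n//; congr (_ `^ _); lra.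
have s0 : 0 < s by exact: pow0.
have gV : gamma^-1 = G * T%:R `^ (- (c / 2)).
  rewrite /gamma invrK; congr (_ * _); apply/eqP.
  rewrite -(eqrXn2 (n := 2)) ?sqrtr_ge0 ?ltW// sqr_sqrtr ?ltW// etaE -powRN.
  by rewrite expr2 -powD; apply/eqP; congr (_ `^ _); lra.
have vE : violation T g x = gamma^-1 * \sum_j q T j 0.
  by rewrite (run_sum_q run)// mulKf// gt_eqF.
have sumq : \sum_j q T j 0 <= (m%:R + 2 * (B + L + 2 * F)) / 2 * s.
  have := sum_le_dot (q T) s0; rewrite -/S.
  have : S / s <= 2 * (B + L + 2 * F) * s by rewrite ler_pdivrMr// -[leRHS]mulrA s2.
  lra.
have -> : 1 / 2 - c / 2 = - (c / 2) + 1 / 2 by ring.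
rewrite powD -/s vE gV.
apply: le_trans (_ : V * (T%:R `^ (- (c / 2)) * s) <= _).
  have Gp : 0 <= G * T%:R `^ (- (c / 2)) by rewrite mulr_ge0 ?ltW.
  by have := ler_wpM2l Gp sumq; rewrite /V; lra.
by apply: ler_wpM2r; rewrite ?KE ?lerDr// -powD ltW.
Qed.
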